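(* Let $H$ be a graph. The class of $H$-free graphs is bounded-apex-perfect if and only if $H$ is an induced subgraph of $P_4$.
   Context: All graphs are finite and simple. $P_4$ is the path on four vertices. ''Induced subgraph of $X$'' means isomorphic to $X[S]$ for some $S\subseteq V(X)$. A graph is $H$-free if none of its induced subgraphs is isomorphic to $H$. A graph $G$ is perfect if $\omega(F)=\chi(F)$ for every induced subgraph $F$ of $G$. A class of graphs is bounded-apex-perfect if there is a constant $c\in\mathbb{N}$ such that every graph $G$ in the class has a set $S\subseteq V(G)$ with $|S|\le c$ such that $G-S$ is perfect. *)

(* Defs.v *)
From mathcomp Require Import all_boot.

Set Implicit Arguments.
Unset Strict Implicit.
Unset Printing Implicit Defensive.

Record graph := Graph {
  vertex :> finType;
  edge : rel vertex;
  edge_sym : symmetric edge;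
  edge_irrefl : irreflexive edge }.

Definition isomorphic (G H : graph) : Prop :=
  exists2 f : G -> H, bijective f & forall x y, edge (f x) (f y) = edge x y.

Section Induced.
Variables (G : graph) (S : {set G}).

Definition induced_edge : rel {x : G | x \in S} :=
  fun x y => edge (val x) (val y).

Lemma induced_edge_sym : symmetric induced_edge.
Proof. by move=> x y; apply: edge_sym. Qed.

Lemma induced_edge_irrefl : irreflexive induced_edge.
Proof. by move=> x; apply: edge_irrefl. Qed.

Definition induced : graph := Graph induced_edge_sym induced_edge_irrefl.
End Induced.

Definition induced_subgraph (F G : graph) : Prop :=
  exists S : {set G}, isomorphic F (induced S).

Definition free (H G : graph) : Prop :=
  forall F : graph, induced_subgraph F G -> ~ isomorphic F H.

Definition clique (G : graph) (K : {set G}) : bool :=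
  [forall x in K, forall y in K, (x != y) ==> edge x y].

Definition omega (G : graph) : nat := \max_(K : {set G} | clique K) #|K|.

Definition colorable (G : graph) (k : nat) : bool :=
  [exists c : {ffun G -> 'I_k}, forall x, forall y, edge x y ==> (c x != c y)].

Lemma colorable_card (G : graph) : exists k, colorable G k.
Proof.
exists #|G|; apply/existsP; exists [ffun x => enum_rank x].
apply/forallP=> x; apply/forallP=> y; apply/implyP=> xy; rewrite !ffunE.
by apply: contraTneq xy => /enum_rank_inj ->; rewrite edge_irrefl.
Qed.

Definition chi (G : graph) : nat := ex_minn (colorable_card G).

Definition perfect (G : graph) : Prop :=
  forall F : graph, induced_subgraph F G -> omega F = chi F.

Definition bounded_apex_perfect (C : graph -> Prop) : Prop :=
  exists c : nat, forall G : graph, C G ->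
    exists2 S : {set G}, #|S| <= c & perfect (induced (~: S)).

Section Path.
Variable n : nat.

Definition path_edge : rel 'I_n := fun i j => (i.+1 == j) || (j.+1 == i).

Lemma path_edge_sym : symmetric path_edge.
Proof. by move=> i j; rewrite /path_edge orbC. Qed.

Lemma path_edge_irrefl : irreflexive path_edge.
Proof. by move=> i; rewrite /path_edge orbb gtn_eqF. Qed.

(* [n] counts vertices, not edges. *)
Definition path_graph : graph := Graph path_edge_sym path_edge_irrefl.
End Path.

(* Main.v *)
Require Import Defs.
From mathcomp Require Import all_boot.
From mathcomp Require Import zify.

(** The equivalence has two independent halves.

    If [H] is an induced subgraph of P_4, every [H]-free graph is P_4-free,
    and P_4-free graphs are perfect, so no vertex needs to be deleted.
    Perfection is seen on a proper colouring by natural numbers of least sum.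
    There every vertex has a neighbour of each smaller colour, as it could
    otherwise be recoloured.  Starting from a vertex of the largest colour, one
    grows a clique downwards through the colours: among the vertices of the
    next colour, one with the most neighbours in the clique is adjacent to all
    of it, for otherwise two vertices of that colour and two of the clique
    induce a P_4 ([P4_free_clique_extend]).  The clique reaches colour 0, so it
    has as many vertices as there are colours ([P4_free_omega_chi]).

    Conversely, let [c] be a bound for the class and [G] a graph with
    omega <> chi.  Both the disjoint union and the join of [c + 1] copies of
    [G] keep an intact copy of [G] after the deletion of [c] vertices, hence
    neither is [H]-free ([apex_perfect_copies]).  With [G] = C_5, the graph [H]
    lies in a disjoint union and in a join of 5-cycles, which forces it into a
    single one ([embeds_union_join]).  If the embedding misses a vertex, [H]
    lies in P_4.  Otherwise C_5 lies in [H], and so, with [G] = C_7, in a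
    disjoint union of 7-cycles; this one maps homomorphically to C_7, but a
    map from C_5 to C_7 misses a vertex, so that C_5 would be mapped into a
    path and would be bipartite. *)

Set Implicit Arguments.
Unset Strict Implicit.
Unset Printing Implicit Defensive.

(** * Embeddings *)

(** A boolean version of being an induced subgraph: decidability is what turns
    not being [H]-free into an actual copy of [H]. *)
Definition embeds (F G : graph) : bool :=
  [exists f : {ffun F -> G},
    injectiveb f && [forall x, forall y, edge (f x) (f y) == edge x y]].

Lemma embedsP (F G : graph) :
  reflect (exists2 f : F -> G,
             injective f & forall x y, edge (f x) (f y) = edge x y)
          (embeds F G).
Proof.
apply: (iffP existsP) => [[f /andP[/injectiveP injf /forallP fE]]|[f injf fE]].
  by exists f => // x y; apply/eqP; have /forallP := fE x; apply.
exists [ffun x => f x]; apply/andP; split.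
  by apply/injectiveP => x y; rewrite !ffunE => /injf.
by apply/forallP => x; apply/forallP => y; rewrite !ffunE fE.
Qed.

Lemma embeds_trans (F G K : graph) : embeds F G -> embeds G K -> embeds F K.
Proof.
move=> /embedsP[f injf fE] /embedsP[g injg gE]; apply/embedsP.
by exists (g \o f) => [|x y]; [apply: inj_comp | rewrite /= gE fE].
Qed.

Lemma embeds_induced (G : graph) (S : {set G}) : embeds (induced S) G.
Proof. by apply/embedsP; exists val => //; apply: val_inj. Qed.

Lemma embeds_iso (F G : graph) : isomorphic F G -> embeds F G.
Proof. by case=> f /bij_inj injf fE; apply/embedsP; exists f. Qed.

Lemma embeds_iso_sym (F G : graph) : isomorphic F G -> embeds G F.
Proof.
case=> f [g fK gK] fE; apply/embedsP; exists g => [|x y].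
  exact: can_inj gK.
by rewrite -fE !gK.
Qed.

Lemma induced_subgraphE (F G : graph) : induced_subgraph F G <-> embeds F G.
Proof.
split=> [[S /embeds_iso FS]|/embedsP[f injf fE]].
  exact: embeds_trans FS (embeds_induced S).
have fS x : f x \in [set f y | y : F] by apply: imset_f.
exists [set f y | y : F].
exists (fun x => exist _ (f x) (fS x) : induced [set f y | y : F]) => //.
apply: inj_card_bij => [x y [/injf] //|].
by rewrite card_sig card_imset.
Qed.

Lemma freeE (H G : graph) : free H G <-> ~~ embeds H G.
Proof.
split=> [freeG|nHG F /induced_subgraphE FG /embeds_iso_sym HF].
  apply/negP => /induced_subgraphE[S HS].
  apply: (freeG (induced S)); first by exists S; exists id => //; exists id.
  by case: HS => f [g fK gK] fE; exists g => [|x y]; [exists f | rewrite -fE !gK].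
by move/negP: nHG; apply; apply: embeds_trans FG.
Qed.

(** * Cliques and colourings *)

Lemma cliqueP (G : graph) (K : {set G}) :
  reflect {in K &, forall x y, x != y -> edge x y} (clique K).
Proof.
apply: (iffP forall_inP) => [cK x y xK yK | cK x xK].
  by have /forall_inP/(_ y yK)/implyP := cK x xK.
by apply/forall_inP => y yK; apply/implyP; apply: cK.
Qed.

Lemma colorableP (G : graph) (k : nat) :
  reflect (exists c : G -> 'I_k, forall x y, edge x y -> c x != c y)
          (colorable G k).
Proof.
apply: (iffP existsP) => [[c /forallP cP] | [c cP]].
  by exists c => x y; have /forallP/(_ y)/implyP := cP x.
exists [ffun x => c x]; apply/forallP => x; apply/forallP => y.
by rewrite !ffunE; apply/implyP; apply: cP.
Qed.

Lemma colorable_chi (G : graph) : colorable G (chi G).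
Proof. by rewrite /chi; case: ex_minnP. Qed.

Lemma chi_le (G : graph) (k : nat) : colorable G k -> chi G <= k.
Proof. by rewrite /chi; case: ex_minnP => m _; apply. Qed.

Lemma colorable_leq (G : graph) (k l : nat) :
  k <= l -> colorable G k -> colorable G l.
Proof.
move=> kl /colorableP[c cP]; apply/colorableP.
by exists (fun x => widen_ord kl (c x)) => x y /cP.
Qed.

Lemma colorable_hom (F G : graph) (f : F -> G) (k : nat) :
  (forall x y, edge x y -> edge (f x) (f y)) ->
  colorable G k -> colorable F k.
Proof.
move=> fE /colorableP[c cP]; apply/colorableP.
by exists (c \o f) => x y /fE/cP.
Qed.

Lemma colorable2P (G : graph) :
  reflect (exists c : G -> bool, forall x y, edge x y -> c x != c y)
          (colorable G 2).
Proof.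
apply: (iffP (colorableP G 2)) => [[c cP]|[c cP]].
  exists (fun x => c x == ord0) => x y /cP.
  by case: (c x) (c y) => [[|[|]] //= ?] [[|[|]] //= ?].
exists (fun x => inord (c x)) => x y /cP; apply: contra => /eqP/(congr1 val).
by rewrite /= !inordK; [case: (c x) (c y) => [] [] | case: (c y) | case: (c x)].
Qed.

Lemma clique_le_omega (G : graph) (K : {set G}) : clique K -> #|K| <= omega G.
Proof. by move=> cK; apply: (bigmax_sup K). Qed.

Lemma omega_le_chi (G : graph) : omega G <= chi G.
Proof.
have /colorableP[c cP] := colorable_chi G.
apply/bigmax_leqP => K /cliqueP cK.
have injc : {in K &, injective c}.
  move=> x y xK yK /eqP; apply: contraTeq => xy.
  exact: cP (cK x y xK yK xy).
by rewrite -(card_in_imset injc) -[X in _ <= X]card_ord max_card.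
Qed.

(** * P4-free graphs are perfect *)

(** Injectivity comes for free: no two vertices of P_4 have the same
    neighbourhood. *)
Lemma embeds_P4 (G : graph) (a b c d : G) :
  edge a b -> edge b c -> edge c d ->
  ~~ edge a c -> ~~ edge b d -> ~~ edge a d ->
  embeds (path_graph 4) G.
Proof.
move=> ab bc cd /negPf ac /negPf bd /negPf ad.
pose f (i : path_graph 4) := nth a [:: a; b; c; d] i.
have fE x y : edge (f x) (f y) = edge x y.
  case: x y => [[|[|[|[|]]]] //= ?] [[|[|[|[|]]]] //= ?]; rewrite /f /=;
  by rewrite ?edge_irrefl ?ab ?bc ?cd ?ac ?bd ?ad // edge_sym
             ?ab ?bc ?cd ?ac ?bd ?ad.
apply/embedsP; exists f => // x y fxy.
have nbr z : edge x z = edge y z by rewrite -!fE fxy.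
have := (nbr (inord 0), nbr (inord 1), nbr (inord 2), nbr (inord 3)).
rewrite /= /path_edge !inordK // => nbrE; apply: val_inj.
by case: x y {fxy nbr} nbrE => [[|[|[|[|]]]] //= ?] [[|[|[|[|]]]] //= ?] [[[]]].
Qed.

(** A vertex [u] of colour [i] with the most neighbours in [K] is adjacent to
    all of [K]: if it missed [w], a neighbour [v] of [w] of colour [i] would
    miss some neighbour [z] of [u] in [K], and [u], [z], [w], [v] would induce
    a P_4. *)
Lemma P4_free_clique_extend (G : graph) (c : G -> nat) (i : nat)
    (K : {set G}) :
  ~~ embeds (path_graph 4) G ->
  (forall x y, edge x y -> c x != c y) ->
  clique K -> K != set0 ->
  {in K, forall x, exists2 u, edge x u & c u = i} ->
  exists2 u, c u = i & {in K, forall x, edge u x}.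
Proof.
move=> noP4 cP /cliqueP cK /set0Pn[x0 x0K] nbr.
have [u0 _ /eqP cu0] := nbr x0 x0K.
pose N u := [set x in K | edge u x].
case: (@arg_maxnP _ u0 (fun u => c u == i) (fun u => #|N u|) cu0).
move=> u /eqP cu maxu; exists u => // w wK; apply: contraNT noP4 => uw.
have [v wv cv] := nbr w wK.
have [z zNu zNv] : exists2 z, z \in N u & z \notin N v.
  apply/subsetPn/negP => subN.
  have /proper_card : N u \proper N v.
    apply/properP; split=> //; exists w; rewrite !inE wK //.
    by rewrite edge_sym.
  by rewrite ltnNge => /negP[]; apply: maxu; rewrite cv.
move: zNu zNv; rewrite !inE => /andP[zK uz]; rewrite zK /= => vz.
apply: (@embeds_P4 _ u z w v) => //.
- by apply: cK => //; apply: contraNneq uw => <-.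
- by rewrite edge_sym.
- by apply/negP => /cP; rewrite cu cv eqxx.
Qed.

(** Take a proper colouring of least colour sum: recolouring a vertex with a
    smaller colour absent from its neighbourhood would decrease the sum. *)
Lemma greedy_coloring (G : graph) :
  exists2 c : G -> nat, (forall x y, edge x y -> c x != c y) &
    forall x i, i < c x -> exists2 u, edge x u & c u = i.
Proof.
pose proper (c : {ffun G -> 'I_#|G|}) :=
  [forall x, forall y, edge x y ==> (c x != c y)].
pose c0 : {ffun G -> 'I_#|G|} := [ffun x => enum_rank x].
have properP (c : {ffun G -> 'I_#|G|}) :
    reflect (forall x y, edge x y -> c x != c y) (proper c).
  apply: (iffP forallP) => [cP x y|cP x].
    by have /forallP/(_ y)/implyP := cP x.
  by apply/forallP => y; apply/implyP; apply: cP.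
have proper0 : proper c0.
  apply/properP => x y xy; rewrite !ffunE.
  by apply: contraTneq xy => /enum_rank_inj ->; rewrite edge_irrefl.
case: (@arg_minnP _ c0 proper (fun c => \sum_x c x) proper0).
move=> c /properP cP minc; exists (fun x => val (c x)) => // x i ix.
have [/existsP[u /andP[xu /eqP cu]]|] :=
  boolP [exists u, edge x u && (val (c u) == i)]; first by exists u.
rewrite negb_exists => /forallP nbr.
pose i' := Ordinal (ltn_trans ix (ltn_ord (c x))).
pose c' := [ffun y => if y == x then i' else c y].
have nbr' y : edge x y -> c y != i'.
  by move=> xy; have := nbr y; rewrite xy.
have proper' : proper c'.
  apply/properP => y z yz; rewrite !ffunE.
  case: (eqVneq y x) (eqVneq z x) yz => [->|_] [->|_] yz.
  - by rewrite edge_irrefl in yz.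
  - by rewrite eq_sym nbr'.
  - by rewrite nbr' // edge_sym.
  - exact: cP.
have := minc c' proper'; rewrite leqNgt => /negP[].
rewrite (bigD1 x) // [X in _ < X](bigD1 x) //= ffunE eqxx.
by rewrite (eq_bigr (fun y => val (c y))) => [|y /negPf yx];
  rewrite ?ltn_add2r // ffunE yx.
Qed.

Lemma P4_free_omega_chi (G : graph) :
  ~~ embeds (path_graph 4) G -> omega G = chi G.
Proof.
move=> noP4; apply/eqP; rewrite eqn_leq omega_le_chi /=.
have [c cP greedy] := greedy_coloring G.
have [x0 _|G0] := pickP (@predT G); last first.
  have noG (x : G) : False by have := G0 x.
  apply/chi_le/colorableP.
  by exists (fun x => False_rect _ (noG x)) => x; case: (noG x).
have [t _ maxt] := @arg_maxnP _ x0 predT c isT.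
(* The clique obtained after adding [d] further colours below the largest. *)
have big d : d <= c t -> exists2 K : {set G}, clique K &
    #|K| = d.+1 /\ {in K, forall x, c t - d <= c x}.
  elim: d => [|d IHd] dt.
    exists [set t]; last by rewrite cards1; split=> // x /set1P->; rewrite subn0.
    by apply/cliqueP => x y /set1P-> /set1P->; rewrite eqxx.
  have [K cK [cardK leK]] := IHd (ltnW dt).
  have ltK x : x \in K -> c t - d.+1 < c x by move/leK; lia.
  have K0 : K != set0 by rewrite -card_gt0 cardK.
  have [u cu uK] := P4_free_clique_extend noP4 cP cK K0
    (fun x xK => greedy x _ (ltK x xK)).
  have uNK : u \notin K by apply/negP => /ltK; rewrite cu ltnn.
  exists (u |: K); last first.
    by rewrite cardsU1 uNK cardK; split=> // x /setU1P[->|/ltK/ltnW];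
      rewrite ?cu.
  apply/cliqueP => x y /setU1P[->|xK] /setU1P[->|yK]; first by rewrite eqxx.
  - by move=> _; apply: uK.
  - by move=> _; rewrite edge_sym; apply: uK.
  - by move/cliqueP: cK; apply.
have [K cK [cardK _]] := big (c t) (leqnn _).
apply: leq_trans (clique_le_omega cK); rewrite cardK; apply/chi_le/colorableP.
exists (fun x => inord (c x)) => x y /cP; apply: contra => /eqP/(congr1 val).
by rewrite /= !inordK ?ltnS; [move=> -> | exact: maxt..].
Qed.

Lemma P4_free_perfect (G : graph) :
  ~~ embeds (path_graph 4) G -> perfect G.
Proof.
move=> noP4 F /induced_subgraphE FG; apply: P4_free_omega_chi.
by apply: contra noP4 => P4F; apply: embeds_trans FG.
Qed.

(** * Odd cycles *)

(** Indexed from the triangle on, so that every [cycle_graph n] is simple; its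
    length [n + 3] is odd exactly when [n] is even. *)
Definition cycle_edge (n : nat) : rel 'I_n.+3 := fun i j =>
  path_edge i j || ((i == 0 :> nat) && (j == n.+2 :> nat))
  || ((j == 0 :> nat) && (i == n.+2 :> nat)).

Lemma cycle_edge_sym n : symmetric (@cycle_edge n).
Proof. by move=> i j; rewrite /cycle_edge path_edge_sym orbAC. Qed.

Lemma cycle_edge_irrefl n : irreflexive (@cycle_edge n).
Proof. by move=> i; rewrite /cycle_edge /path_edge; lia. Qed.

Definition cycle_graph (n : nat) : graph :=
  Graph (@cycle_edge_sym n) (@cycle_edge_irrefl n).

(** Renumber the remaining vertices from the successor of [v] on. *)
Lemma cycle_minus_vertex (n : nat) (v : cycle_graph n) :
  exists2 g : cycle_graph n -> path_graph n.+2,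
    {in predC1 v &, injective g} &
    {in predC1 v &, forall x y, edge (g x) (g y) = edge x y}.
Proof.
pose g (x : 'I_n.+3) := if v < x then x - v.+1 else x + n.+2 - v.
have gE (x : 'I_n.+3) : x != v -> (inord (g x) : 'I_n.+2) = g x :> nat.
  rewrite -val_eqE /= => xv; apply: inordK; rewrite /g.
  by move: (ltn_ord x) (ltn_ord v); case: ifP; lia.
exists (fun x => inord (g x)) => x y; rewrite !inE => xv yv.
  move=> /(congr1 val) /=; rewrite !gE // => gxy; apply: val_inj => /=.
  move: gxy xv yv; rewrite -!val_eqE /= /g.
  by move: (ltn_ord x) (ltn_ord y) (ltn_ord v); do 2!case: ifP; lia.
rewrite /= /cycle_edge /path_edge !gE // /g; move: xv yv; rewrite -!val_eqE /=.
by move: (ltn_ord x) (ltn_ord y) (ltn_ord v); do 2!case: ifP; lia.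
Qed.

Lemma path_bipartite (n : nat) : colorable (path_graph n) 2.
Proof.
apply/colorable2P; exists (fun x : 'I_n => odd x) => x y /= /orP[] /eqP <- /=.
  by case: (odd x).
by case: (odd y).
Qed.

Lemma odd_cycle_not_bipartite (n : nat) :
  ~~ odd n -> ~~ colorable (cycle_graph n) 2.
Proof.
move=> evn; apply/negP => /colorable2P[c cP].
have alt i : i < n.+3 -> c (inord i) = c ord0 (+) odd i.
  elim: i => [_|i IHi iln]; first by rewrite addbF; congr c; apply: val_inj;
    rewrite /= inordK.
  have : c (inord i) != c (inord i.+1).
    by apply: cP; rewrite /= /cycle_edge /path_edge !inordK ?eqxx // ltnW.
  by rewrite IHi ?(ltnW iln) //= addbN; case: (_ (+) _); case: (c _).
have : c ord0 != c (inord n.+2).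
  by apply: cP; rewrite /= /cycle_edge /path_edge !inordK // !eqxx orbT.
by rewrite alt //= negbK (negPf evn) addbF eqxx.
Qed.

Lemma cycle_omega (n : nat) : 0 < n -> omega (cycle_graph n) <= 2.
Proof.
move=> n0; apply/bigmax_leqP => K /cliqueP cK; rewrite leqNgt; apply/negP.
move=> /card_gt2P[x [y [z [[xK yK zK] [xy yz zx]]]]].
move: (cK _ _ xK yK xy) (cK _ _ yK zK yz) (cK _ _ zK xK zx).
rewrite /= /cycle_edge /path_edge.
by move: (ltn_ord x) (ltn_ord y) (ltn_ord z); lia.
Qed.

Lemma odd_cycle_omega_chi (n : nat) :
  0 < n -> ~~ odd n -> omega (cycle_graph n) != chi (cycle_graph n).
Proof.
move=> n0 /odd_cycle_not_bipartite; apply: contraNneq => oc.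
apply: (colorable_leq (cycle_omega n0)); rewrite oc; exact: colorable_chi.
Qed.

(** A map to a longer cycle misses a vertex, hence lands in a path, and a
    2-colouring of that path would pull back to the odd cycle. *)
Lemma odd_cycle_hom (m n : nat) (f : cycle_graph m -> cycle_graph n) :
  ~~ odd m -> m < n -> ~ (forall x y, edge x y -> edge (f x) (f y)).
Proof.
move=> evm mn fE.
have /existsP[v vf] : [exists v, v \notin codom f].
  rewrite -negb_forall; apply/negP => /forallP surj.
  have : #|cycle_graph n| <= #|cycle_graph m|.
    by apply: leq_trans (leq_image_card f predT); apply/subset_leq_card/subsetP.
  by rewrite !card_ord; lia.
have fv x : f x \in predC1 v.
  by rewrite inE; apply: contraNneq vf => <-; apply: codom_f.
have [g _ gE] := cycle_minus_vertex v.
case/negP: (odd_cycle_not_bipartite evm).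
apply: (colorable_hom (f := g \o f)) (path_bipartite n.+2) => x y xy.
exact: etrans (gE _ _ (fv x) (fv y)) (fE x y xy).
Qed.

(** * Copies of a graph *)

(** The flag [b] tells whether vertices of different copies are adjacent:
    the disjoint union for [false], the join for [true]. *)
Definition copies_edge (b : bool) (m : nat) (G : graph) : rel ('I_m * G) :=
  fun p q => if p.1 == q.1 then edge p.2 q.2 else b.

Lemma copies_edge_sym b m G : symmetric (@copies_edge b m G).
Proof. by move=> p q; rewrite /copies_edge eq_sym edge_sym. Qed.

Lemma copies_edge_irrefl b m G : irreflexive (@copies_edge b m G).
Proof. by move=> p; rewrite /copies_edge eqxx edge_irrefl. Qed.

Definition copies (b : bool) (m : nat) (G : graph) : graph :=
  Graph (@copies_edge_sym b m G) (@copies_edge_irrefl b m G).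

(** Some copy avoids any given set of fewer than [m] vertices. *)
Lemma copies_imperfect (b : bool) (m : nat) (G : graph)
    (S : {set copies b m G}) :
  omega G != chi G -> #|S| < m -> ~ perfect (induced (~: S)).
Proof.
move=> /eqP oc Sm perf; apply/oc/perf/induced_subgraphE.
have /existsP[i iS] : [exists i : 'I_m, i \notin [set p.1 | p in S]].
  rewrite -negb_forall; apply/negP => /forallP sub.
  have : #|[set: 'I_m]| <= #|[set p.1 | p in S]|.
    by apply/subset_leq_card/subsetP.
  rewrite cardsT card_ord leqNgt => /negP[].
  exact: leq_ltn_trans (leq_imset_card _ _) Sm.
have iS' x : ((i, x) : copies b m G) \in ~: S.
  by rewrite inE; apply: contra iS => xS; apply/imsetP; exists (i, x).
apply/embedsP; exists (fun x => exist _ (i, x) (iS' x) : induced (~: S)).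
  by move=> x y [].
by move=> x y; rewrite /= /induced_edge /= /copies_edge eqxx.
Qed.

Lemma apex_perfect_copies (H G : graph) :
  bounded_apex_perfect (free H) -> omega G != chi G ->
  forall b, exists m, embeds H (copies b m G).
Proof.
move=> [c apex] oc b; exists c.+1; apply: contraT => /freeE/apex[S Sc].
by move/copies_imperfect; case.
Qed.

(** Two vertices of [H] in different copies are non-adjacent for the first
    embedding and adjacent for the second one; so any two vertices share a copy
    in one of them.  As two equivalence relations whose union is total cannot
    both be proper, one of the embeddings stays in a single copy. *)
Lemma embeds_union_join (H G : graph) (m n : nat) :
  embeds H (copies false m G) -> embeds H (copies true n G) -> embeds H G.
Proof.
have single b k (f : H -> copies b k G) : injective f ->
    (forall x y, edge (f x) (f y) = edge x y) ->
    (forall x y, (f x).1 = (f y).1) -> embeds H G.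
  move=> injf fE f1; apply/embedsP; exists (fun x => (f x).2) => x y.
    by move=> f2; apply: injf; apply/eqP; rewrite -pair_eqE /= (f1 x y) f2 !eqxx.
  by rewrite -fE /= /copies_edge (f1 x y) eqxx.
move=> /embedsP[f injf fE] /embedsP[g injg gE].
have same x y : (f x).1 != (f y).1 -> (g x).1 = (g y).1.
  move=> fxy; apply/eqP; apply: contraT => gxy; have := fE x y.
  by rewrite -gE /= /copies_edge (negPf fxy) (negPf gxy).
have [/forallP f1|] := boolP [forall x, forall y, (f x).1 == (f y).1].
  by apply: single injf fE _ => x y; have /forallP/(_ y)/eqP := f1 x.
move=> /forallPn[x /forallPn[y fxy]]; apply: single injg gE _ => u v.
have gx w : (g w).1 = (g x).1.
  have [fwx|/same //] := eqVneq (f w).1 (f x).1.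
  by rewrite (same x y fxy); apply: same; rewrite fwx.
by rewrite !gx.
Qed.

(** * The equivalence *)

Theorem theorem2p4 (H : graph) :
  bounded_apex_perfect (free H) <-> induced_subgraph H (path_graph 4).
Proof.
split=> [apex|/induced_subgraphE HP4]; last first.
  exists 0 => G /freeE noH; exists set0; first by rewrite cards0.
  apply: P4_free_perfect; apply: contra noH => P4G.
  apply: embeds_trans HP4 (embeds_trans P4G (embeds_induced _)).
apply/induced_subgraphE.
(* With the shift by 3 in [cycle_graph], these are the 5- and the 7-cycle. *)
have C5 : omega (cycle_graph 2) != chi (cycle_graph 2).
  exact: odd_cycle_omega_chi.
have C7 : omega (cycle_graph 4) != chi (cycle_graph 4).
  exact: odd_cycle_omega_chi.
have [m5 Hunion] := apex_perfect_copies apex C5 false.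
have [n5 Hjoin] := apex_perfect_copies apex C5 true.
have [m7 /embedsP[h _ hE]] := apex_perfect_copies apex C7 false.
have /embedsP[f injf fE] := embeds_union_join Hunion Hjoin.
have [/forallP surj|/forallPn[v vf]] := boolP [forall v, v \in codom f].
  (* An inverse of [f], followed by [h] and the projection from the disjoint
     union of 7-cycles to C_7. *)
  pose f' v := iinv (surj v).
  case: (@odd_cycle_hom 2 4 (fun v => (h (f' v)).2)) => // x y xy.
  have : edge (h (f' x)) (h (f' y)) by rewrite hE -fE !f_iinv.
  by rewrite /= /copies_edge; case: ifP.
have fv x : f x \in predC1 v.
  by rewrite inE; apply: contraNneq vf => <-; apply: codom_f.
have [g injg gE] := cycle_minus_vertex v.
apply/embedsP; exists (g \o f) => [x y /= /injg fxy|x y].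
  by apply: injf; apply: fxy.
exact: etrans (gE _ _ (fv x) (fv y)) (fE x y).
Qed.
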